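(* Let $R$ be a ring and $X$ a nonempty set of not necessarily commuting indeterminates. Then the following conditions are equivalent: (i) $R$ is a right $\mathfrak{cP}$-Baer ring; (ii) the polynomial ring $R[X]$ is a right $\mathfrak{cP}$-Baer ring; (iii) the formal power series ring $R[[X]]$ is a right $\mathfrak{cP}$-Baer ring.
   Context: All rings are associative with identity (not necessarily commutative). For a subset $S$ of a ring $R$, $r_R(S)=\{a\in R : sa=0 \text{ for all } s\in S\}$. A ring $R$ is right $\mathfrak{cP}$-Baer if for every idempotent $e=e^2\in R$ there is an idempotent $c=c^2\in R$ with $r_R(eR)=cR$. Indeterminates in $X$ commute with all elements of $R$ but not necessarily with one another: let $M$ be the monoid of monomials generated by $X$, subject only to the relations $xy=yx$ for those pairs $x,y\in X$ that are declared to commute (possibly none, possibly all pairs). $R[X]$ is the ring of finite $R$-linear combinations of elements of $M$, and $R[[X]]$ is the ring of all formal sums $\sum_{w\in M}a_w w$ with $a_w\in R$, with addition coefficientwise and product $\left(\sum_u a_u u\right)\left(\sum_v b_v v\right)=\sum_{w}\left(\sum_{uv=w}a_ub_v\right)w$ (each $w\in M$ has only finitely many factorizations $w=uv$). *)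

(* Defs.v *)
From HB Require Import structures.
From Stdlib Require Import Relation_Operators.
From mathcomp Require Import all_boot all_algebra.
From mathcomp Require Import mathcomp_extra boolp classical_sets functions.
From mathcomp Require Import cardinality fsbigop.

Set Implicit Arguments.
Unset Strict Implicit.
Unset Printing Implicit Defensive.

Import GRing.Theory.

Local Open Scope quotient_scope.
Local Open Scope classical_set_scope.
Local Open Scope ring_scope.

(* [pzRingType] is the structure of associative rings with identity, the zero
   ring included. *)
Section RightCPBaer.
Context (R : pzRingType).

Definition right_annihilator (S : set R) : set R :=
  [set a | forall s, S s -> s * a = 0].

Definition principal_right_ideal (e : R) : set R := [set e * x | x in setT].

Definition right_cP_Baer : Prop :=
  forall e : R, e * e = e ->
    exists2 c : R, c * c = c &
      right_annihilator (principal_right_ideal e) = principal_right_ideal c.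

End RightCPBaer.

(* The monoid of monomials is the quotient of the free monoid of words on [X] by
   the congruence that exchanges adjacent letters declared to commute; the
   relation [comm] need not be symmetric, reflexive or transitive. The alias
   [{classic X}] of [X] carries the classical decidable equality. *)
Section Monomials.
Context (X : Type) (comm : X -> X -> Prop).

Local Notation word := (seq {classic X}).

Inductive swap_adjacent : word -> word -> Prop :=
  SwapAdjacent (l r : word) (x y : {classic X}) : comm x y ->
    swap_adjacent (l ++ [:: x, y & r]) (l ++ [:: y, x & r]).

Definition same_monomial (s t : word) : bool :=
  `[< clos_refl_sym_trans _ swap_adjacent s t >].

Lemma same_monomial_refl : reflexive same_monomial.
Proof. by move=> s; apply/asboolP/rst_refl. Qed.

Lemma same_monomial_sym : symmetric same_monomial.
Proof. by move=> s t; apply/asboolP/asboolP; apply: rst_sym. Qed.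

Lemma same_monomial_trans : transitive same_monomial.
Proof.
by move=> t s u /asboolP st /asboolP tu; apply/asboolP; apply: rst_trans st tu.
Qed.

Canonical same_monomial_equiv :=
  EquivRel same_monomial same_monomial_refl same_monomial_sym
           same_monomial_trans.

Definition monomial := {eq_quot same_monomial_equiv}.
HB.instance Definition _ := Choice.on monomial.
HB.instance Definition _ := EqQuotient.on monomial.

Lemma same_monomial_cat s s' t t' : same_monomial s s' -> same_monomial t t' ->
  same_monomial (s ++ t) (s' ++ t').
Proof.
move=> ss' tt'; apply: (same_monomial_trans (y := s' ++ t)).
  move: ss' => /asboolP ss'; apply/asboolP.
  elim: ss' => {s s'} [_ _ [l r x y cxy]|s|s s' _|s s' s'' _ + _].
  - by rewrite -!catA !cat_cons; apply: rst_step; constructor.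
  - exact: rst_refl.
  - exact: rst_sym.
  - exact: rst_trans.
move: tt' => /asboolP tt'; apply/asboolP.
elim: tt' => {t t'} [_ _ [l r x y cxy]|t|t t' _|t t' t'' _ + _].
- by rewrite !(catA s'); apply: rst_step; constructor.
- exact: rst_refl.
- exact: rst_sym.
- exact: rst_trans.
Qed.

Lemma same_monomial_perm s t : same_monomial s t -> perm_eq s t.
Proof.
move=> /asboolP; elim=> {s t} [_ _ [l r x y _]|s|s t _ st|s t u _ st _ tu].
- by rewrite perm_cat2l; apply/permP => a /=; rewrite addnCA.
- exact: perm_refl.
- by rewrite perm_sym.
- exact: perm_trans st tu.
Qed.

Definition monomial_one : monomial := \pi_monomial [::].
Definition monomial_mul (u v : monomial) : monomial :=
  \pi_monomial (repr u ++ repr v).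

Lemma same_monomial_repr s : same_monomial (repr (\pi_monomial s)) s.
Proof.
by rewrite -[same_monomial _ _]/(same_monomial_equiv _ _) -eqmodE reprK.
Qed.

Lemma monomial_pi_eq s t : same_monomial s t -> \pi_monomial s = \pi_monomial t.
Proof. by move=> st; apply/eqmodP. Qed.

Lemma monomial_mulA : associative monomial_mul.
Proof.
move=> u v w; apply: monomial_pi_eq.
apply: (same_monomial_trans (y := repr u ++ (repr v ++ repr w))).
  by apply: same_monomial_cat; rewrite ?same_monomial_refl ?same_monomial_repr.
rewrite catA same_monomial_sym.
by apply: same_monomial_cat; rewrite ?same_monomial_refl ?same_monomial_repr.
Qed.

Lemma monomial_mul1g : left_id monomial_one monomial_mul.
Proof.
move=> u; rewrite -[RHS]reprK; apply: monomial_pi_eq.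
rewrite -[X in same_monomial _ X]cat0s.
by apply: same_monomial_cat; rewrite ?same_monomial_refl ?same_monomial_repr.
Qed.

Lemma monomial_mulg1 : right_id monomial_one monomial_mul.
Proof.
move=> u; rewrite -[RHS]reprK; apply: monomial_pi_eq.
rewrite -[X in same_monomial _ X]cats0.
by apply: same_monomial_cat; rewrite ?same_monomial_refl ?same_monomial_repr.
Qed.

HB.instance Definition _ :=
  isMonoid.Build monomial monomial_mulA monomial_mul1g monomial_mulg1.

Lemma finite_infixes (w : monomial) : exists2 S : seq monomial, uniq S &
  forall x u y : monomial, (x * u * y)%g = w -> u \in S.
Proof.
pose I := iota 0 (size (repr w)).+1.
pose infixes := [seq take p.2 (drop p.1 t) | t <- permutations (repr w),
                                             p <- [seq (m, n) | m <- I, n <- I]].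
exists (undup [seq \pi_monomial s | s <- infixes]); first exact: undup_uniq.
move=> x u y xuyw; rewrite mem_undup -[u]reprK; apply: map_f.
have /same_monomial_perm pw :
    same_monomial (repr x ++ repr u ++ repr y) (repr w).
  rewrite catA same_monomial_sym -xuyw.
  apply: same_monomial_trans (same_monomial_repr _) _.
  by apply: same_monomial_cat; rewrite ?same_monomial_repr ?same_monomial_refl.
apply/allpairsP.
exists (repr x ++ repr u ++ repr y, (size (repr x), size (repr u))).
split; first by rewrite mem_permutations.
  have sw := perm_size pw; rewrite !size_cat in sw.
  have inI m : (m <= size (repr w))%N -> m \in I by rewrite mem_iota add0n ltnS.
  by apply/allpairsP; exists (size (repr x), size (repr u)); split=> //=;
    apply: inI; rewrite -sw ?leq_addr// addnCA leq_addr.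
by rewrite /= drop_size_cat// take_size_cat.
Qed.

Lemma finite_factorizations (w : monomial) :
  finite_set [set p : monomial * monomial | (p.1 * p.2)%g = w].
Proof.
have [S _ inS] := finite_infixes w.
apply: (@sub_finite_set _ _ [set` allpairs pair S S]); last exact: finite_seq.
move=> [u v] /= uvw; apply: allpairs_f.
  by apply: (inS 1%g _ v); rewrite mul1g.
by apply: (inS u _ 1%g); rewrite mulg1.
Qed.

End Monomials.

Section PowerSeries.
Context (R : pzRingType) (X : Type) (comm : X -> X -> Prop).
Local Notation M := (monomial comm).

Record power_series := PowerSeries { coefficient :> M -> R }.

HB.instance Definition _ := [isNew for coefficient].
HB.instance Definition _ := [Choice of power_series by <:].

Implicit Types a b c : power_series.

Lemma power_seriesP a b : a =1 b -> a = b.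
Proof. by move=> /funext ab; apply: val_inj. Qed.

Definition series_zero := PowerSeries (fun=> 0).
Definition series_opp a := PowerSeries (fun w => - a w).
Definition series_add a b := PowerSeries (fun w => a w + b w).

Lemma series_addA : associative series_add.
Proof. by move=> a b c; apply: power_seriesP => w /=; rewrite addrA. Qed.

Lemma series_addC : commutative series_add.
Proof. by move=> a b; apply: power_seriesP => w /=; rewrite addrC. Qed.

Lemma series_add0r : left_id series_zero series_add.
Proof. by move=> a; apply: power_seriesP => w /=; rewrite add0r. Qed.

Lemma series_addNr : left_inverse series_zero series_opp series_add.
Proof. by move=> a; apply: power_seriesP => w /=; rewrite addNr. Qed.

HB.instance Definition _ := GRing.isZmodule.Build power_series
  series_addA series_addC series_add0r series_addNr.

Definition series_one := PowerSeries (fun w => (w == 1%g)%:R).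

(* The index set is finite by [finite_factorizations]. *)
Definition series_mul a b := PowerSeries (fun w =>
  \sum_(p \in [set p : M * M | (p.1 * p.2)%g = w]) a p.1 * b p.2).

Lemma series_mulE a b (S : seq M) (w : M) : uniq S ->
    (forall u v : M, (u * v)%g = w -> u \in S /\ v \in S) ->
  series_mul a b w =
    \sum_(u <- S) \sum_(v <- S) if (u * v)%g == w then a u * b v else 0.
Proof.
move=> uS inS /=.
transitivity (\sum_(p <- [seq p <- allpairs pair S S | (p.1 * p.2)%g == w])
                 a p.1 * b p.2).
  rewrite [RHS]fsbig_seq; last first.
    by rewrite filter_uniq// allpairs_uniq// => -[? ?] [? ?].
  apply: eq_fsbigl; apply/seteqP; split=> -[u v] /=; rewrite mem_filter /=.
    move=> uvw; rewrite uvw eqxx /=; have [uS' vS'] := inS _ _ uvw.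
    exact: allpairs_f.
  by move=> /andP[/eqP].
rewrite big_filter big_mkcond big_allpairs /=.
by apply: eq_bigr => u _.
Qed.

Lemma sum_pick (S : seq M) (F : M -> R) w : uniq S -> w \in S \/ F w = 0 ->
  \sum_(v <- S) (if v == w then F v else 0) = F w.
Proof.
move=> uS [wS|Fw0].
  rewrite (bigD1_seq w)//= eqxx big1 ?addr0// => v.
  by case: (v == w).
by rewrite Fw0 big1// => v _; case: eqP => // ->.
Qed.

Lemma infixes_seq (w : M) : exists2 S : seq M, uniq S &
  [/\ w \in S, 1%g \in S,
      forall u v : M, (u * v)%g = w -> u \in S /\ v \in S &
      forall x u y : M, (x * u * y)%g = w -> u \in S].
Proof.
have [S uS inS] := finite_infixes w; exists S => //; split.
- by apply: (inS 1%g _ 1%g); rewrite mul1g mulg1.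
- by apply: (inS w _ 1%g); rewrite !mulg1.
- move=> u v uvw; split; first by apply: (inS 1%g _ v); rewrite mul1g.
  by apply: (inS u _ 1%g); rewrite mulg1.
- exact: inS.
Qed.

Lemma series_mulA : associative series_mul.
Proof.
move=> a b c; apply: power_seriesP => w.
have [S uS [_ _ in2 inS]] := infixes_seq w.
rewrite !(series_mulE _ _ uS in2); symmetry.
transitivity (\sum_(u <- S) \sum_(v <- S) \sum_(t <- S)
    if (u * v * t)%g == w then a u * b v * c t else 0).
  transitivity (\sum_(p <- S) \sum_(t <- S) \sum_(u <- S) \sum_(v <- S)
      if p == (u * v)%g then
        if (p * t)%g == w then a u * b v * c t else 0 else 0).
    apply: eq_bigr => p _; apply: eq_bigr => t _; case: eqP => [ptw|_]; last first.
      by rewrite big1// => u _; rewrite big1// => v _; case: ifP.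
    rewrite (series_mulE _ _ uS); last first.
      move=> u v uvp; split.
        by apply: (inS 1%g _ (v * t)%g); rewrite mul1g mulgA uvp.
      by apply: (inS u _ t); rewrite uvp.
    rewrite mulr_suml; apply: eq_bigr => u _.
    rewrite mulr_suml; apply: eq_bigr => v _.
    by rewrite [p == _]eq_sym; case: ifP; rewrite ?mul0r.
  under eq_bigr => p _ do (rewrite exchange_big /=; under eq_bigr => u _ do
    rewrite exchange_big /=).
  rewrite exchange_big; apply: eq_bigr => u _.
  rewrite exchange_big; apply: eq_bigr => v _.
  rewrite exchange_big; apply: eq_bigr => t _.
  rewrite (@sum_pick S (fun p => if (p * t)%g == w then _ else 0) _ uS)//.
  case: eqP => uvtw; [left|by right].
  by apply: (inS 1%g _ t); rewrite mul1g.
apply: eq_bigr => u _; symmetry.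
transitivity (\sum_(p <- S) \sum_(v <- S) \sum_(t <- S)
    if p == (v * t)%g then
      if (u * p)%g == w then a u * b v * c t else 0 else 0).
  apply: eq_bigr => p _; case: eqP => [upw|_]; last first.
    by rewrite big1// => v _; rewrite big1// => t _; case: ifP.
  rewrite (series_mulE _ _ uS); last first.
    move=> v t vtp; split.
      by apply: (inS u _ t); rewrite -mulgA vtp.
    by apply: (inS (u * v)%g _ 1%g); rewrite mulg1 -mulgA vtp.
  rewrite mulr_sumr; apply: eq_bigr => v _.
  rewrite mulr_sumr; apply: eq_bigr => t _.
  by rewrite [p == _]eq_sym; case: ifP; rewrite ?mulr0// mulrA.
rewrite exchange_big; apply: eq_bigr => v _.
rewrite exchange_big; apply: eq_bigr => t _.
rewrite (@sum_pick S (fun p => if (u * p)%g == w then _ else 0) _ uS) ?mulgA//.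
case: eqP => uvtw; [left|by right].
by apply: (inS u _ 1%g); rewrite mulg1 mulgA.
Qed.

Lemma series_mul1r : left_id series_one series_mul.
Proof.
move=> a; apply: power_seriesP => w.
have [S uS [wS oneS in2 _]] := infixes_seq w.
rewrite (series_mulE _ _ uS in2) exchange_big /=.
rewrite -[RHS](sum_pick uS (or_introl wS)); apply: eq_bigr => v _.
have := @sum_pick S (fun u => if (u * v)%g == w then a v else 0)
  _ uS (or_introl oneS).
rewrite mul1g => <-.
by apply: eq_bigr => u _; case: (u == 1%g); rewrite ?mul1r ?mul0r//; case: ifP.
Qed.

Lemma series_mulr1 : right_id series_one series_mul.
Proof.
move=> a; apply: power_seriesP => w.
have [S uS [wS oneS in2 _]] := infixes_seq w.
rewrite (series_mulE _ _ uS in2).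
rewrite -[RHS](sum_pick uS (or_introl wS)); apply: eq_bigr => u _.
have := @sum_pick S (fun v => if (u * v)%g == w then a u else 0)
  _ uS (or_introl oneS).
rewrite mulg1 => <-.
by apply: eq_bigr => v _ /=; case: (v == 1%g);
  rewrite ?mulr1 ?mulr0//; case: ifP.
Qed.

Lemma series_mulDl : left_distributive series_mul series_add.
Proof.
move=> a b c; apply: power_seriesP => w.
have [S uS [_ _ in2 _]] := infixes_seq w.
rewrite [RHS]/= -![\sum_(_ \in _) _]/(series_mul _ _ w).
rewrite !(series_mulE _ _ uS in2) -big_split; apply: eq_bigr => u _ /=.
by rewrite -big_split; apply: eq_bigr => v _; case: ifP;
  rewrite /= ?addr0// mulrDl.
Qed.

Lemma series_mulDr : right_distributive series_mul series_add.
Proof.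
move=> a b c; apply: power_seriesP => w.
have [S uS [_ _ in2 _]] := infixes_seq w.
rewrite [RHS]/= -![\sum_(_ \in _) _]/(series_mul _ _ w).
rewrite !(series_mulE _ _ uS in2) -big_split; apply: eq_bigr => u _ /=.
by rewrite -big_split; apply: eq_bigr => v _; case: ifP;
  rewrite /= ?addr0// mulrDr.
Qed.

HB.instance Definition _ := GRing.Zmodule_isPzRing.Build power_series
  series_mulA series_mul1r series_mulr1 series_mulDl series_mulDr.

(* [{malg R[M]}] of multinomials requires a nontrivial coefficient ring; the
   subring of finitely supported series also makes sense over the zero ring. *)
Definition finitely_supported : {pred power_series} :=
  fun a => `[< finite_set [set w | a w != 0] >].

Lemma finitely_supported_subring : subring_closed finitely_supported.
Proof.
split=> [|a b|a b].
- apply/asboolP; apply: (@sub_finite_set _ _ [set 1%g]); last exact: finite_set1.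
  by move=> w /=; case: (w =P 1%g) => //; rewrite eqxx.
- move=> /asboolP fa /asboolP fb; apply/asboolP.
  apply: (@sub_finite_set _ _ ([set w | a w != 0] `|` [set w | b w != 0])).
    move=> w /=; have [a0|] := eqVneq (a w) 0; last by left.
    by have [b0|] := eqVneq (b w) 0; [rewrite a0 b0 subr0 eqxx|right].
  by rewrite finite_setU.
- move=> /asboolP fa /asboolP fb; apply/asboolP.
  apply: (@sub_finite_set _ _ [set (u * v)%g | u in [set w | a w != 0] &
                                               v in [set w | b w != 0]]).
    move=> w /= abw0; apply: contrapT => nw; move: abw0.
    rewrite fsbig1 ?eqxx// => -[u v] /= uvw.
    have [->|au] := eqVneq (a u) 0; first by rewrite mul0r.
    have [->|bv] := eqVneq (b v) 0; first by rewrite mulr0.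
    by case: nw; exists u => //; exists v.
  exact: finite_image2.
Qed.

HB.instance Definition _ :=
  GRing.isSubringClosed.Build power_series finitely_supported
    finitely_supported_subring.

Record polynomial_ring := PolynomialRing {
  polynomial_series :> power_series;
  _ : polynomial_series \in finitely_supported }.

HB.instance Definition _ := [isSub for polynomial_series].
HB.instance Definition _ := [Choice of polynomial_ring by <:].
HB.instance Definition _ :=
  GRing.SubChoice_isSubPzRing.Build power_series finitely_supported
    polynomial_ring finitely_supported_subring.

End PowerSeries.

(* Main.v *)
(** For an idempotent series E with constant coefficient e, the right
    annihilator of E S is generated by the idempotent c that generates the right
    annihilator of e R. Comparing coefficients by induction on the degree,
    E = E E gives E_w c = 0 for every monomial w, and E x g = 0 for all x in R
    gives (1 - c) g_w = 0. In the other direction, if C generates the right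
    annihilator of e S for a constant e, then its constant coefficient generates
    that of e R. The argument only uses that S is a ring of series containing
    the constants, so it covers R[X] and R[[X]] at once. *)
Require Import Defs.
From mathcomp Require Import all_boot all_algebra.
From mathcomp Require Import boolp classical_sets cardinality fsbigop.

Set Implicit Arguments.
Unset Strict Implicit.
Unset Printing Implicit Defensive.

Import GRing.Theory.

Local Open Scope classical_set_scope.
Local Open Scope ring_scope.

Lemma principal_right_idealP (R : pzRingType) (c a : R) : c * c = c ->
  principal_right_ideal c a <-> c * a = a.
Proof.
by move=> cc; split=> [[x _ <-]|<-]; [rewrite mulrA cc|exists a].
Qed.

Lemma right_annihilatorP (R : pzRingType) (e a : R) :
  right_annihilator (principal_right_ideal e) a <-> forall x, e * x * a = 0.
Proof.
by split=> [ea x|ea _ [x _ <-]]; [apply: ea; exists x|exact: ea].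
Qed.

(** For an idempotent [c], lying in [c R] means being fixed by [c] on the left, so the equality of
    ideals becomes a statement about equations that ring morphisms transport. *)
Lemma right_cP_BaerP (R : pzRingType) : right_cP_Baer R <->
  forall e : R, e * e = e ->
    exists2 c : R, c * c = c &
      forall a, (forall x, e * x * a = 0) <-> c * a = a.
Proof.
split=> H e /H [c cc ec]; exists c => //.
  move=> a; rewrite -(principal_right_idealP a cc) -ec.
  exact: iff_sym (right_annihilatorP _ _).
apply/seteqP; split=> a.
  by move=> /right_annihilatorP /ec /(principal_right_idealP a cc).
by move=> /(principal_right_idealP a cc) /ec /right_annihilatorP.
Qed.

Section Degree.
Context (X : Type) (comm : X -> X -> Prop).
Local Notation M := (monomial comm).

(** Swaps only permute letters, so the length does not depend on the chosen representative. *)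
Definition monomial_degree (u : M) : nat := size (repr u).

Lemma monomial_degreeM (u v : M) :
  monomial_degree (u * v)%g = (monomial_degree u + monomial_degree v)%N.
Proof.
rewrite /monomial_degree -size_cat; apply: perm_size.
exact: same_monomial_perm (same_monomial_repr comm _).
Qed.

Lemma monomial_degree1 : monomial_degree 1%g = 0%N.
Proof.
by apply/eqP; rewrite -(eqn_add2l (monomial_degree 1%g)) -monomial_degreeM
  mulg1 addn0.
Qed.

Lemma monomial_degree_eq0 (u : M) : monomial_degree u = 0%N -> u = 1%g.
Proof. by move=> /size0nil u0; rewrite -[u]reprK u0. Qed.

(** Degrees add and only the unit has degree 0; this makes the inductions on degree work. *)
Lemma monomial_degree_ltr (u v w : M) : (u * v)%g = w -> (u, v) <> (1%g, w) ->
  (monomial_degree v < monomial_degree w)%N.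
Proof.
move=> <- ne; rewrite monomial_degreeM -[ltnLHS]add0n ltn_add2r lt0n.
apply: contra_notN ne => /eqP /monomial_degree_eq0 ->.
by rewrite mul1g.
Qed.

Lemma monomial_ind (P : M -> Prop) :
  (forall w, (forall v, (monomial_degree v < monomial_degree w)%N -> P v) ->
    P w) -> forall w, P w.
Proof.
move=> IH w; have [n] := ubnP (monomial_degree w).
elim: n w => // n IHn w; rewrite ltnS => wn.
by apply: IH => v vw; apply: IHn; apply: leq_trans vw wn.
Qed.

End Degree.

Section Series.
Context (R : pzRingType) (X : Type) (comm : X -> X -> Prop).
Local Notation M := (monomial comm).
Implicit Types (a b : power_series R comm) (r : R) (u v w : M).

Lemma coef_mul1 a b w u0 v0 : (u0 * v0)%g = w ->
    (forall u v, (u * v)%g = w -> (u, v) <> (u0, v0) -> a u * b v = 0) ->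
  (a * b) w = a u0 * b v0.
Proof.
move=> uv0 ab0.
rewrite -[LHS]/(\sum_(q \in [set q : M * M | (q.1 * q.2)%g = w]) a q.1 * b q.2).
rewrite -(fsbig_widen [set (u0, v0)]) ?fsbig_set1//; first by move=> _ ->.
by move=> [u v] [] /= uvw ne; exact: ab0.
Qed.

Lemma coef_mul0 a b w : (forall u v, (u * v)%g = w -> a u * b v = 0) ->
  (a * b) w = 0.
Proof.
move=> ab0; rewrite (@coef_mul1 _ _ _ 1%g w) ?mul1g//= => [|u v /ab0//].
by rewrite ab0 ?mul1g.
Qed.

Lemma coef_mul_one a b : (a * b) 1%g = a 1%g * b 1%g.
Proof.
apply: (@coef_mul1 _ _ _ 1%g 1%g) => [|u v uv1 ne]; first exact: mul1g.
have := monomial_degree_ltr uv1 ne.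
by rewrite monomial_degree1.
Qed.

Definition constant_series r : power_series R comm :=
  PowerSeries (fun w => if w == 1%g then r else 0).

Lemma coef_constant_mul r a w : (constant_series r * a) w = r * a w.
Proof.
rewrite (@coef_mul1 _ _ _ 1%g w) ?mul1g//= ?eqxx// => u v uvw ne.
case: eqP => [u1|_]; last by rewrite mul0r.
by case: ne; rewrite -uvw u1 mul1g.
Qed.

Lemma coef_mul_constant r a w : (a * constant_series r) w = a w * r.
Proof.
rewrite (@coef_mul1 _ _ _ w 1%g) ?mulg1//= ?eqxx// => u v uvw ne.
case: eqP => [v1|_]; last by rewrite mulr0.
by case: ne; rewrite -uvw v1 mulg1.
Qed.

Lemma constant_seriesM r s :
  constant_series (r * s) = constant_series r * constant_series s.
Proof.
apply: power_seriesP => w; rewrite coef_constant_mul /=.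
by case: eqP; rewrite ?mulr0.
Qed.

Lemma constant_series_finitely_supported r :
  constant_series r \in @finitely_supported R X comm.
Proof.
apply/asboolP; apply: (@sub_finite_set _ _ [set 1%g]); last exact: finite_set1.
by move=> w /=; case: (w =P 1%g) => //; rewrite eqxx.
Qed.

Section Annihilator.
Variables (E : power_series R comm) (c : R).
Hypothesis EE : E * E = E.
Hypothesis ann_e : forall r, (forall x, E 1%g * x * r = 0) <-> c * r = r.
Hypothesis cc : c * c = c.

(** In the coefficient of [E * (E * c)] at [w], the terms with a right factor shorter than [w]
    vanish by induction; what remains is [E 1 * E w * c], zero because [c] annihilates [E 1 * R]. *)
Lemma idempotent_coef_mul_ann w : E w * c = 0.
Proof.
elim/monomial_ind: w => w IH.
rewrite -EE -coef_mul_constant -mulrA (@coef_mul1 _ _ _ 1%g w) ?mul1g//.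
  by rewrite coef_mul_constant mulrA; apply: (ann_e c).2.
move=> u v uvw ne.
by rewrite coef_mul_constant IH ?mulr0// (monomial_degree_ltr uvw).
Qed.

Lemma idempotent_mul_ann a : E * a * constant_series c = 0.
Proof.
apply: power_seriesP => w; rewrite -mulrA; apply: coef_mul0 => u v _.
rewrite coef_mul_constant.
(* The right annihilator of a right ideal is two-sided, so it contains [a v * c]; the extra [c] on
   the left then meets [E u]. *)
have <- : c * (a v * c) = a v * c.
  by apply/ann_e => x; rewrite mulrA -(mulrA _ x); apply: (ann_e c).2.
by rewrite mulrA idempotent_coef_mul_ann mul0r.
Qed.

(** By induction on degree, the coefficient of [E * x * b] at [w] reduces to [E 1 * x * b w]. Hence
    [b w] is fixed by [c], and [c * b w] is a coefficient of the zero series. *)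
Lemma ann_idempotent_eq0 b : constant_series c * b = 0 ->
  (forall x, E * constant_series x * b = 0) -> b = 0.
Proof.
move=> cb0 Eb; apply: power_seriesP; elim/monomial_ind => w IH.
rewrite [RHS]/= -[RHS](congr1 (fun a : power_series R comm => a w) cb0).
rewrite coef_constant_mul; apply/esym/ann_e => x.
have := congr1 (fun a : power_series R comm => a w) (Eb x).
rewrite (@coef_mul1 _ _ _ 1%g w) ?mul1g// ?coef_mul_constant// => u v uvw ne.
by rewrite IH ?mulr0// (monomial_degree_ltr uvw).
Qed.

End Annihilator.

Section Transfer.
Variables (S : pzRingType) (phi : {rmorphism S -> power_series R comm}).
Variable const : R -> S.
Hypothesis phi_inj : injective phi.
Hypothesis phi_const : forall r, phi (const r) = constant_series r.

Lemma constM r s : const (r * s) = const r * const s.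
Proof. by apply: phi_inj; rewrite rmorphM/= !phi_const constant_seriesM. Qed.

Lemma series_ring_cP_Baer : right_cP_Baer R -> right_cP_Baer S.
Proof.
move=> /right_cP_BaerP RB; apply/right_cP_BaerP => E EE.
have FF : phi E * phi E = phi E by rewrite -rmorphM EE.
have [|c cc ec] := RB (phi E 1%g); first by rewrite -coef_mul_one FF.
exists (const c) => [|f]; first by rewrite -constM cc.
have Ec x : E * x * const c = 0.
  by apply: phi_inj; rewrite !rmorphM rmorph0/= phi_const
    (idempotent_mul_ann FF ec cc).
split=> [Ef|<- x]; last by rewrite mulrA Ec mul0r.
(* The difference [f - const c * f] is killed by [const c] and by each [E * const x], hence is
   zero. *)
apply/esym/eqP; rewrite -subr_eq0; apply/eqP/phi_inj; rewrite rmorph0.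
apply: (ann_idempotent_eq0 ec) => [|x]; rewrite -phi_const -!rmorphM.
  by rewrite mulrBr mulrA -constM cc subrr rmorph0.
by rewrite mulrBr Ef mulrA Ec mul0r subrr rmorph0.
Qed.

Lemma cP_Baer_of_series_ring : right_cP_Baer S -> right_cP_Baer R.
Proof.
move=> /right_cP_BaerP SB; apply/right_cP_BaerP => e ee.
have [|C CC eC] := SB (const e); first by rewrite -constM ee.
have cc : phi C 1%g * phi C 1%g = phi C 1%g.
  by rewrite -coef_mul_one -rmorphM CC.
exists (phi C 1%g) => // a; split=> [ea|<- x].
  (* Each coefficient of [e * x * a] has the form [e * r * a = 0], so [const a] is fixed by [C]; the
     claim is the constant coefficient of this equation. *)
  have /(congr1 (fun f => phi f 1%g)) : C * const a = const a.
    apply/eC => x; apply: phi_inj; apply: power_seriesP => w.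
    by rewrite !rmorphM rmorph0 !phi_const coef_mul_constant
      coef_constant_mul ea.
  by rewrite rmorphM !phi_const coef_mul_constant /= eqxx.
(* Being idempotent, [C] lies in the annihilator it generates. *)
have /(congr1 (fun f => phi f 1%g)) := (eC C).2 CC (const x).
rewrite !rmorphM rmorph0 !phi_const coef_mul_one coef_mul_constant /= eqxx.
by move=> exC; rewrite mulrA exC mul0r.
Qed.

End Transfer.

End Series.

Theorem theorem2p16 (R : pzRingType) (X : Type) (comm : X -> X -> Prop) :
  inhabited X ->
  [<-> right_cP_Baer R;
       right_cP_Baer (polynomial_ring R comm);
       right_cP_Baer (power_series R comm)].
Proof.
move=> _.
pose polyC (r : R) :=
  PolynomialRing (constant_series_finitely_supported comm r).
have val_inj_poly : injective (val : polynomial_ring R comm -> _) := val_inj.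
have id_inj : injective (idfun : power_series R comm -> _) by [].
tfae.
- exact: (series_ring_cP_Baer (const := polyC) val_inj_poly (fun=> erefl)).
(* The passage from polynomials to power series goes through [R]. *)
- move=> /(cP_Baer_of_series_ring (const := polyC) val_inj_poly (fun=> erefl)).
  exact: (series_ring_cP_Baer id_inj (fun=> erefl)).
- exact: (cP_Baer_of_series_ring id_inj (fun=> erefl)).
Qed.
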